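(* Let $Q=\mathrm{Dih}(m,G,\alpha)$ be a finite dihedral-like automorphic loop such that either $\alpha\neq1$ or $\exp(G)>2$. Then: (i) $\mathrm{Inn}_r(Q)=\mathrm{Inn}_\ell(Q)$ is isomorphic to the subgroup $\langle\alpha\rangle\ltimes G(1-\alpha)$ of $\mathrm{Hol}(G)$; (ii) $\mathrm{Inn}(Q)=\langle T_x,R_{x,y}:x,y\in Q\rangle=\langle T_x,L_{x,y}:x,y\in Q\rangle$ is isomorphic to the subgroup $(\pm\langle\alpha\rangle)\ltimes(2G+G(1-\alpha))$ of $\mathrm{Hol}(G)$.
   Context: Let $m\ge 2$ be an even integer, $G$ an abelian group (written additively) and $\alpha\in\mathrm{Aut}(G)$, where $\alpha^2=1$ is required if $m>2$ (no condition on $\alpha$ if $m=2$). The dihedral-like automorphic loop $\mathrm{Dih}(m,G,\alpha)$ is the loop defined on $\mathbb{Z}_m\times G$ by $(i,u)(j,v)=(i+j,(s_ju+v)\alpha^{ij})$, where $s_j=(-1)^j$, $i,j\in\{0,\dots,m-1\}$, the first coordinate is added modulo $m$, and the exponent $ij$ is the integer product, not reduced modulo $m$. Its identity element is $(0,0)$. Maps are written to the right of their arguments and are composed from left to right. The condition $\exp(G)>2$ means that $2u\ne0$ for some $u\in G$. For a loop $Q$ and $x\in Q$, the translations are $yL_x=xy$ and $yR_x=yx$. The multiplication group is $\mathrm{Mlt}(Q)=\langle L_x,R_x:x\in Q\rangle$, and the inner mapping group is $\mathrm{Inn}(Q)=\{\varphi\in\mathrm{Mlt}(Q):1\varphi=1\}$.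 Put $L_{x,y}=L_xL_yL_{yx}^{-1}$, $R_{x,y}=R_xR_yR_{xy}^{-1}$, $T_x=R_xL_x^{-1}$, and $\mathrm{Inn}_r(Q)=\langle R_{x,y}:x,y\in Q\rangle$, $\mathrm{Inn}_\ell(Q)=\langle L_{x,y}:x,y\in Q\rangle$. The holomorph $\mathrm{Hol}(G)=\mathrm{Aut}(G)\ltimes G$ is the set $\mathrm{Aut}(G)\times G$ with multiplication $(\alpha,u)(\beta,v)=(\alpha\beta,u\beta+v)$. For a subgroup $A\le\mathrm{Aut}(G)$ and an $A$-invariant subgroup $H\le G$, $A\ltimes H$ denotes the subgroup $\{(a,u):a\in A,\,u\in H\}$ of $\mathrm{Hol}(G)$. Here $G(1-\alpha)=\{u-u\alpha:u\in G\}$, $2G=\{2u:u\in G\}$, and $\pm\langle\alpha\rangle=\{\varepsilon\alpha^i:\varepsilon\in\{1,-1\},\,i\in\mathbb{Z}\}\le\mathrm{Aut}(G)$, where $-1$ is the automorphism $u\mapsto-u$. *)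

(* Defs.v *)
From HB Require Import structures.
From mathcomp Require Import all_boot all_order all_algebra all_fingroup.

Set Implicit Arguments.
Unset Strict Implicit.
Unset Printing Implicit Defensive.

Import GRing.Theory.
Local Open Scope group_scope.

Record finLoopType := FinLoop {
  loop_sort :> finType;
  loop_mul : loop_sort -> loop_sort -> loop_sort;
  loop_one : loop_sort;
  loop_mul1 : left_id loop_one loop_mul;
  loop_mulr1 : right_id loop_one loop_mul;
  loop_mull_bij : forall x, bijective (fun y => loop_mul x y);
  loop_mulr_bij : forall x, bijective (fun y => loop_mul y x)
}.

Local Notation "x ** y" := (loop_mul x y) (at level 40, left associativity).

(* The product s * t of {perm Q} is "s, then t": maps act on the right. *)
Section LoopGroups.
Variable Q : finLoopType.
Implicit Types x y : Q.

Definition ltrans x : {perm Q} := perm (bij_inj (loop_mull_bij x)).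
Definition rtrans x : {perm Q} := perm (bij_inj (loop_mulr_bij x)).

Definition Mlt : {set {perm Q}} :=
  <<[set ltrans x | x : Q] :|: [set rtrans x | x : Q]>>.

Definition Inn : {set {perm Q}} := [set phi in Mlt | phi (loop_one Q) == loop_one Q].

Fact Inn_group_set : group_set Inn.
Proof.
apply/group_setP; split=> [|s t]; first by rewrite inE group1 perm1 eqxx.
rewrite !inE => /andP[Ms /eqP s1] /andP[Mt /eqP t1].
by rewrite groupM //= permM s1 t1.
Qed.
Canonical Inn_group := group Inn_group_set.

Definition linner x y : {perm Q} := ltrans x * ltrans y * (ltrans (y ** x))^-1.
Definition rinner x y : {perm Q} := rtrans x * rtrans y * (rtrans (x ** y))^-1.
Definition tinner x : {perm Q} := rtrans x * (ltrans x)^-1.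

Definition linners : {set {perm Q}} := [set linner x y | x : Q, y : Q].
Definition rinners : {set {perm Q}} := [set rinner x y | x : Q, y : Q].
Definition tinners : {set {perm Q}} := [set tinner x | x : Q].

Definition Inn_l : {set {perm Q}} := <<linners>>.
Definition Inn_r : {set {perm Q}} := <<rinners>>.

End LoopGroups.

Arguments Mlt : clear implicits.
Arguments Inn : clear implicits.
Arguments linners : clear implicits.
Arguments rinners : clear implicits.
Arguments tinners : clear implicits.
Arguments Inn_l : clear implicits.
Arguments Inn_r : clear implicits.

(* Dih(m, G, alpha). The carrier is Z_m * G only for m > 1, as 'Z_0 and 'Z_1 *)
(* are both Z/2. These operations form a loop for any permutation alpha.     *)
Definition dih (m : nat) (G : finZmodType) (alpha : {perm G}) : Type :=
  ('Z_m * G)%type.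

Section Dihedral.
Variables (m : nat) (G : finZmodType) (alpha : {perm G}).
Local Notation Q := (dih m alpha).
Implicit Types x y : Q.

(* The exponents of -1 and alpha are natural numbers: 'Z_m coerces to nat by *)
(* the representative in {0, ..., m - 1}, and i * j below is not reduced.    *)
Definition dih_mul x y : Q :=
  let: (i, u) := x in let: (j, v) := y in
  ((i + j)%R, (alpha ^+ (i * j)%N) (u *~ (-1) ^+ j + v)%R).

Definition dih_one : Q := (0%R, 0%R).

Fact dih_mul1 : left_id dih_one dih_mul.
Proof. by case=> j v; rewrite /dih_mul /= add0r mul0n expg0 perm1 mul0rz add0r. Qed.

Fact dih_mulr1 : right_id dih_one dih_mul.
Proof. by case=> i u; rewrite /dih_mul /= addr0 muln0 expg0 perm1 mulr1z addr0. Qed.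

HB.instance Definition _ := Finite.on Q.

Fact dih_mull_bij x : bijective (fun y : Q => dih_mul x y).
Proof.
apply: injF_bij; case: x => i u [j v] [k w]; rewrite /dih_mul => e.
have /addrI jk := congr1 fst e; case: k / jk e => e.
by have /perm_inj/addrI <- := congr1 snd e.
Qed.

Fact dih_mulr_bij x : bijective (fun y : Q => dih_mul y x).
Proof.
apply: injF_bij; case: x => i u [j v] [k w]; rewrite /dih_mul => e.
have /addIr jk := congr1 fst e; case: k / jk e => e.
have /perm_inj/addIr vw := congr1 snd e; congr (_, _).
have sign_inj : injective (fun z : G => z *~ (-1) ^+ i)%R.
  apply: (can_inj (g := fun z => z *~ (-1) ^+ i)%R) => z.
  by rewrite -mulrzA -expr2 sqrr_sign.
exact: sign_inj vw.
Qed.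

Definition dih_loop : finLoopType :=
  FinLoop dih_mul1 dih_mulr1 dih_mull_bij dih_mulr_bij.
End Dihedral.

(* Multiplication in sdprod_by is (a, u) (b, v) = (a b, u b + v) here. *)
Definition hol (G : finZmodType) : finGroupType := sdprod_by [Aut [set: G]].

Section Holomorph.
Variable G : finZmodType.

Definition hol_sub (A : {set {perm G}}) (H : {set G}) : {set hol G} :=
  [set w : hol G | (w.1 \in A) && (w.2 \in H)].

Definition opp_perm : {perm G} := perm (@oppr_inj G).

Definition pm_cycle (alpha : {perm G}) : {set {perm G}} :=
  [set e * a | e in [set 1; opp_perm], a in <[alpha]>].

Definition img_1sub (alpha : {perm G}) : {set G} :=
  [set (u - alpha u)%R | u : G].

Definition img_double : {set G} := [set (u *+ 2)%R | u : G].

Definition sumset (H K : {set G}) : {set G} :=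
  [set (x + y)%R | x in H, y in K].
End Holomorph.

Arguments img_double : clear implicits.

(* Main.v *)
Require Import Defs.
From HB Require Import structures.
From mathcomp Require Import all_boot all_order all_algebra all_fingroup.

Set Implicit Arguments.
Unset Strict Implicit.
Unset Printing Implicit Defensive.

Import GRing.Theory.
Local Open Scope group_scope.

(* As m is even, alpha^(ij) depends only on the parities of i and j: it is    *)
(* alpha if both are odd, and 1 otherwise. This makes every inner generator   *)
(* of the form (i, u) |-> (i, u beta + [i odd] z), with (beta, z) in Hol(G),  *)
(* namely z = 2u, beta = +-1 for T_x, and z in G(1 - alpha), beta in          *)
(* {1, alpha} for R_{x,y} and L_{x,y}. Sending (beta, z) to this map embeds   *)
(* Hol(G) into the symmetric group of Q, and the image is an automorphism of  *)
(* Q as soon as beta commutes with alpha. So the group Phi generated by the   *)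
(* T_x and R_{x,y} acts by automorphisms, hence R_x phi = phi R_{x phi} for   *)
(* phi in Phi, whence Mlt(Q) = Phi R_Q and Inn(Q) = Phi.                      *)

(** Both isomorphisms are restrictions of the single embedding [hol_perm] of the holomorph,
    injective by [injm_hol_perm], so it remains to identify [Inn_r Q], [Inn_l Q] and [Inn Q] with
    the images of two explicit subgroups. The formulas [rinner_hol], [linner_hol] and [tinner_hol]
    put the generators inside these images. Conversely, right or left inner maps with both indices
    odd already give every (alpha, z) with z in G(1 - alpha), which generate the smaller subgroup
    ([gen_hol_sub_cycle]); the maps T_x add the sign and the doubles 2u ([gen_hol_sub_pm_cycle]).
    That nothing else fixes the identity of Q follows from the factorization [Mlt_factor], which
    yields [InnE]. *)

Section AutZmodule.
Variables (G : finZmodType) (a : {perm G}).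
Hypothesis a_aut : a \in Aut [set: G].

Lemma autzD : {morph a : u v / (u + v)%R}.
Proof.
by move=> u v; apply: (morphicP (Aut_morphic a_aut)); rewrite inE.
Qed.

Lemma autz0 : a 0%R = 0%R.
Proof. by apply: (@addrI _ (a 0%R)); rewrite -autzD !addr0. Qed.

Lemma autzN : {morph a : u / (- u)%R}.
Proof. by move=> u; apply: (@addrI _ (a u)); rewrite -autzD !subrr autz0. Qed.

End AutZmodule.

(** * The holomorph and its two subgroups *)

Section HolSub.
Variable G : finZmodType.
Implicit Types (w : hol G) (A : {set {perm G}}) (H K : {set G}).

Lemma hol_aut w : w.1 \in Aut [set: G].
Proof. by case: w => [[a u]] /= /setXP[]. Qed.

(** Elements of [hol G] carry a membership proof; this existence form lets later proofs work with
    the two components only. *)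
Lemma hol_pair_ex (a : {perm G}) (u : G) : a \in Aut [set: G] ->
  exists w : hol G, w.1 = a /\ w.2 = u.
Proof.
move=> aut_a; have aP : (a, u) \in setX (Aut [set: G]) [set: G].
  by apply/setXP; split; last exact: in_setT.
by exists (SdPair [Aut [set: G]] aP).
Qed.

Lemma hol_eq w w' : w.1 = w'.1 -> w.2 = w'.2 -> w = w'.
Proof.
case: w w' => [[a u] aP] [[b v] bP] /= ab uv.
by case: b / ab bP => bP; case: v / uv bP => bP; rewrite (eq_irrelevance aP bP).
Qed.

Lemma hol_mul1 w w' : (w * w').1 = w.1 * w'.1.
Proof. by []. Qed.

Lemma hol_mul2 w w' : (w * w').2 = (w'.1 w.2 + w'.2)%R.
Proof. by []. Qed.

Lemma hol_subP A H w : reflect (w.1 \in A /\ w.2 \in H) (w \in hol_sub A H).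
Proof. by rewrite inE; apply: andP. Qed.

Lemma hol_sub_group_set A H : group_set A -> 0%R \in H ->
    {in H &, forall u v, (u + v)%R \in H} ->
    {in A & H, forall (a : {perm G}) u, a u \in H} ->
  group_set (hol_sub A H).
Proof.
move=> /group_setP[A1 AM] H0 HD HA; apply/group_setP.
split=> [|w w' /hol_subP[Aw Hw] /hol_subP[Aw' Hw']]; first exact/hol_subP.
apply/hol_subP; rewrite hol_mul1 hol_mul2.
by split; [apply: AM | apply: HD => //; apply: HA].
Qed.

Lemma opp_perm_aut : opp_perm G \in Aut [set: G].
Proof.
rewrite inE; apply/andP; split; first by apply/subsetP=> u; rewrite inE.
by apply/morphicP=> u v _ _; rewrite !permE; apply: opprD.
Qed.

Lemma opp_permM : opp_perm G * opp_perm G = 1.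
Proof. by apply/permP=> u; rewrite permM !permE opprK. Qed.

Section Alpha.
Variable alpha : {perm G}.
Hypothesis alpha_aut : alpha \in Aut [set: G].

Lemma pow_aut a : a \in <[alpha]> -> a \in Aut [set: G].
Proof. by apply/subsetP; rewrite cycle_subG. Qed.

Lemma opp_perm_comm : commute (opp_perm G) alpha.
Proof. by apply/permP=> u; rewrite !permM !permE autzN. Qed.

Lemma mem_pm_cycle e a : e \in [set 1; opp_perm G] -> a \in <[alpha]> ->
  e * a \in pm_cycle alpha.
Proof. by move=> Oe Aa; apply/imset2P; exists e a. Qed.

Lemma pm_cycle_commute a : a \in pm_cycle alpha -> commute a alpha.
Proof.
case/imset2P=> e b Oe /cycleP[n ->] ->; apply/commute_sym/commuteM.
  by case/set2P: Oe => ->; [apply: commute1 | apply/commute_sym/opp_perm_comm].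
exact/commuteX/commute_refl.
Qed.

Lemma pm_cycle_aut a : a \in pm_cycle alpha -> a \in Aut [set: G].
Proof.
case/imset2P=> e b /set2P[]-> /pow_aut aut_b ->; first by rewrite mul1g.
by rewrite groupM // opp_perm_aut.
Qed.

(** The map -1 is an involution or trivial and commutes with alpha, so (e a)(f c) = (e f)(a c). *)
Lemma pm_cycle_group_set : group_set (pm_cycle alpha).
Proof.
apply/group_setP; split=> [|_ b /imset2P[e a Oe Aa ->] /imset2P[f c Of Ac ->]].
  by rewrite -[1]mulg1 mem_pm_cycle // !inE eqxx.
have cf : commute a f.
  case/cycleP: Aa => n ->; apply: commute_sym; apply: commuteX.
  by case/set2P: Of => ->; [apply/commute_sym/commute1 | apply: opp_perm_comm].
rewrite -mulgA (mulgA a) cf -!mulgA (mulgA e) mem_pm_cycle ?groupM //.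
by case/set2P: Oe => ->; case/set2P: Of => ->;
  rewrite ?mul1g ?mulg1 ?opp_permM !inE eqxx ?orbT.
Qed.

Lemma img_1sub_pow a u : commute a alpha -> a \in Aut [set: G] ->
  u \in img_1sub alpha -> a u \in img_1sub alpha.
Proof.
move=> ca aut_a /imsetP[v _ ->]; apply/imsetP; exists (a v); rewrite ?inE //.
by rewrite autzD // autzN // -!permM ca.
Qed.

Lemma img_1subD :
  {in img_1sub alpha &, forall u v, (u + v)%R \in img_1sub alpha}.
Proof.
move=> _ _ /imsetP[u _ ->] /imsetP[v _ ->]; apply/imsetP.
exists (u + v)%R => //.
by rewrite autzD // opprD addrACA.
Qed.

Lemma img_1sub0 : 0%R \in img_1sub alpha.
Proof. by apply/imsetP; exists 0%R; rewrite // autz0 // subr0. Qed.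

Lemma hol_sub_cycle_group_set : group_set (hol_sub <[alpha]> (img_1sub alpha)).
Proof.
apply: hol_sub_group_set => [|||a u Aa].
- exact: groupP.
- exact: img_1sub0.
- exact: img_1subD.
apply: img_1sub_pow (pow_aut Aa).
by case/cycleP: Aa => n ->; apply/commute_sym/commuteX.
Qed.

Lemma mem_sumset (H K : {set G}) u v :
  u \in H -> v \in K -> (u + v)%R \in sumset H K.
Proof. by move=> Hu Kv; apply/imset2P; exists u v. Qed.

Lemma hol_sub_pm_cycle_group_set :
  group_set (hol_sub (pm_cycle alpha) (sumset (img_double G) (img_1sub alpha))).
Proof.
apply: hol_sub_group_set => [|||a _ Aa /imset2P[_ v /imsetP[u _ ->] Iv ->]].
- exact: pm_cycle_group_set.
- by rewrite -[0%R]addr0 mem_sumset ?img_1sub0 //; apply/imsetP; exists 0%R;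
    rewrite ?mul0rn.
- move=> _ _ /imset2P[_ v /imsetP[u _ ->] Iv ->]
      /imset2P[_ v' /imsetP[u' _ ->] Iv' ->].
  rewrite addrACA mem_sumset ?img_1subD //.
  apply/imsetP; exists (u + u')%R => //.
  by rewrite mulrnDl.
have aut_a := pm_cycle_aut Aa.
rewrite autzD // mem_sumset //;
  last exact: img_1sub_pow (pm_cycle_commute Aa) _ _.
by apply/imsetP; exists (a u); rewrite // !mulr2n autzD.
Qed.

End Alpha.
End HolSub.

(** * The embedding of the holomorph into the permutations of the loop *)

Section HolAction.
Variables (m : nat) (G : finZmodType) (alpha : {perm G}).
Local Notation Q := (dih_loop m alpha).
Implicit Types (w : hol G) (p : Q).

Definition hol_fun w p : Q :=
  (p.1, if odd p.1 then (w.1 p.2 + w.2)%R else w.1 p.2).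

Lemma hol_fun_inj w : injective (hol_fun w).
Proof.
move=> [i u] [j v] e; have /= ij := congr1 fst e; case: j / ij e => e.
have := congr1 snd e; rewrite /hol_fun /=.
by case: odd => [/addIr|] /perm_inj ->.
Qed.

Definition hol_perm w : {perm Q} := perm (@hol_fun_inj w).

Lemma hol_permM : {in [set: hol G] &, {morph hol_perm : w w' / w * w'}}.
Proof.
move=> w w' _ _; apply/permP=> -[i u]; rewrite permM !permE /hol_fun /=.
by case: odd; rewrite permM // autzD ?hol_aut // addrA.
Qed.

Canonical hol_perm_morphism := Morphism hol_permM.

(** The automorphism is read off on the layer of first coordinate 0, the translation from the image
    of (1, 0). *)
Lemma injm_hol_perm : 'injm hol_perm.
Proof.
apply/injmP=> w w' _ _ /permP e; apply: hol_eq.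
  by apply/permP=> u; have := congr1 snd (e (0%R, u)); rewrite !permE.
have := congr1 snd (e (1%R, 0%R)).
by rewrite !permE /= !autz0 ?hol_aut // !add0r.
Qed.

(** * Parity form of the product, and the inner generators as holomorph elements *)

Hypotheses (m_ge2 : 2 <= m) (m_even : ~~ odd m).
Hypothesis alpha_aut : alpha \in Aut [set: G].
Hypothesis alpha_sqr : 2 < m -> alpha ^+ 2 = 1.

Lemma odd_ZpD (i j : 'Z_m) : odd (i + j)%R = odd i (+) odd j.
Proof. by rewrite /= odd_mod ?oddD // Zp_cast // (negbTE m_even). Qed.

Lemma dih_mulE (i j : 'Z_m) (u v : G) : let s := (if odd j then - u else u)%R in
  dih_mul (alpha := alpha) (i, u) (j, v) =
  ((i + j)%R, if odd i && odd j then alpha (s + v)%R else (s + v)%R).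
Proof.
have sgn : (u *~ (-1) ^+ j = if odd j then - u else u)%R.
  by rewrite -signr_odd; case: odd; rewrite ?mulrN1z ?mulr1z.
congr (_, _); rewrite sgn /= -oddM; set s := (_ + v)%R.
(* For m > 2 the exponent is reduced by alpha^2 = 1; for m = 2 the representatives are 0 and 1, so
   their product is already its own parity. *)
case: (ltnP 2 m) => [/alpha_sqr a2 | m2].
  rewrite -[in LHS](odd_double_half (i * j)) expgD -mul2n expgM a2 expg1n mulg1.
  by case: odd; rewrite ?perm1.
have lt2 (k : 'Z_m) : (k < 2)%N.
  by apply: leq_trans m2; rewrite -[X in (_ < X)%N](Zp_cast m_ge2).
case: (nat_of_ord i) (lt2 i) (nat_of_ord j) (lt2 j) => [|[]] // _ [|[]] //= _.
all: by rewrite ?expg0 ?perm1 ?expg1.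
Qed.

(** Cancelling the final translation characterizes the inner map by an identity of products, without
    computing an inverse. *)
Lemma rinnerE (x y : Q) (f : Q -> Q) : (forall p : Q, dih_mul (dih_mul p x) y =
    dih_mul (f p) (dih_mul x y)) -> rinner x y =1 f.
Proof.
move=> e p; apply: (@perm_inj _ (rtrans (loop_mul x y))).
by rewrite /rinner permM permKV permM !permE; apply: e.
Qed.

Lemma linnerE (x y : Q) (f : Q -> Q) : (forall p : Q, dih_mul y (dih_mul x p) =
    dih_mul (dih_mul y x) (f p)) -> linner x y =1 f.
Proof.
move=> e p; apply: (@perm_inj _ (ltrans (loop_mul y x))).
by rewrite /linner permM permKV permM !permE; apply: e.
Qed.

Lemma tinnerE (x : Q) (f : Q -> Q) :
  (forall p : Q, dih_mul p x = dih_mul x (f p)) ->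
  tinner x =1 f.
Proof.
move=> e p; apply: (@perm_inj _ (ltrans x)).
by rewrite /tinner permM permKV !permE; apply: e.
Qed.

Lemma tinner_hol w (i : 'Z_m) (u : G) :
    w.1 = (if odd i then opp_perm G else 1) -> w.2 = (u *+ 2)%R ->
  tinner ((i, u) : Q) = hol_perm w.
Proof.
move=> w1 w2; apply/permP => p; rewrite [RHS]permE; apply: tinnerE p => -[k v].
have id2 (z : G) : (z + u = - u + (z + u *+ 2))%R.
  by rewrite mulr2n addrCA addKr.
rewrite /hol_fun w1 w2 !dih_mulE /= (addrC k).
case: (odd i); case: (odd k); rewrite /= ?permE -?id2 //.
  by rewrite [(_ + u)%R]addrC.
by rewrite [(_ + u)%R]addrC.
Qed.

Lemma rinner_hol w (i j : 'Z_m) (u v : G) :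
    w.1 = (if odd i && odd j then alpha else 1) ->
    w.2 = (if odd i then
      if odd j then v - alpha v else v - alpha^-1%g v else 0)%R ->
  rinner ((i, u) : Q) ((j, v) : Q) = hol_perm w.
Proof.
move=> w1 w2; apply/permP => p; rewrite [RHS]permE; apply: rinnerE p => -[k z].
rewrite /hol_fun w1 w2 !dih_mulE !odd_ZpD /= addrA.
case: (odd i); case: (odd j); case: (odd k);
  congr (_, _); rewrite /= ?perm1 ?addr0.
all: rewrite ?(autzD, autzN, permKV) // ?opprD ?opprK.
all: try by rewrite addrA.
- by rewrite addrACA subrK.
- by rewrite addrACA (addrAC _ v) addNr add0r.
Qed.

Lemma linner_hol w (i j : 'Z_m) (u v : G) :
    w.1 = (if odd i && odd j then alpha else 1) ->
    w.2 = (if odd i then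
      if odd j then v - alpha v else alpha^-1%g v - v else 0)%R ->
  linner ((i, u) : Q) ((j, v) : Q) = hol_perm w.
Proof.
move=> w1 w2; apply/permP => p; rewrite [RHS]permE; apply: linnerE p => -[k z].
rewrite /hol_fun w1 w2 !dih_mulE !odd_ZpD /= addrA (addrC j).
case: (odd i); case: (odd j); case: (odd k);
  congr (_, _); rewrite /= ?perm1 ?addr0.
all: rewrite ?(autzD, autzN, permKV) // ?opprD ?opprK.
all: try by rewrite addrA.
- by rewrite (addrC _ (v - _)%R) addrACA (addrC (alpha v)) subrK.
- by rewrite (addrC _ (v - _)%R) addrACA (addrC (alpha v)) subrK.
Qed.

(** The translation part is harmless: when both indices are odd the product has even index and the
    sign in the product cancels the two copies of z; when exactly one is odd, z occurs once on each
    side. *)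
Lemma hol_fun_mul w (p q : Q) : commute w.1 alpha ->
  hol_fun w (dih_mul p q) = dih_mul (hol_fun w p) (hol_fun w q) :> Q.
Proof.
case: p q => [i u] [j v] ca; rewrite /hol_fun !dih_mulE !odd_ZpD /=.
congr (_, _); have caE z : w.1 (alpha z) = alpha (w.1 z) by rewrite -!permM ca.
have aut_w := hol_aut w; case: (odd i); case: (odd j) => //=.
all: rewrite ?(caE, autzD, autzN) // ?opprD.
- by rewrite addrACA addNr addr0.
- by rewrite addrAC.
- by rewrite addrA.
Qed.

(** * The subgroups generated by the inner generators *)

Local Notation S1 := (Group (hol_sub_cycle_group_set alpha_aut)).
Local Notation S2 := (Group (hol_sub_pm_cycle_group_set alpha_aut)).

Lemma mem_hol_perm (S : {set hol G}) w :
  w \in S -> hol_perm w \in hol_perm @* S.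
Proof. by move=> Sw; apply: mem_morphim; rewrite ?inE. Qed.

Lemma hol_sub_cycle_subset : S1 \subset S2.
Proof.
apply/subsetP=> w /hol_subP[A1 H2]; apply/hol_subP; split.
  by rewrite -[w.1]mul1g mem_pm_cycle // !inE eqxx.
by rewrite -[w.2]add0r mem_sumset //; apply/imsetP; exists 0%R; rewrite ?mul0rn.
Qed.

Lemma rinner_hol_sub x y : rinner (x : Q) (y : Q) \in hol_perm @* S1.
Proof.
case: x y => [i u] [j v].
have aut : (if odd i && odd j then alpha else 1) \in Aut [set: G].
  by case: ifP => _; rewrite ?group1.
have [w [w1 w2]] := hol_pair_ex (if odd i then if odd j then v - alpha v else
  v - alpha^-1%g v else 0)%R aut.
rewrite (rinner_hol _ w1 w2); apply: mem_hol_perm; apply/hol_subP.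
rewrite w1 w2; split; first by case: ifP; rewrite ?group1 ?cycle_id.
case: (odd i); last exact: img_1sub0.
case: (odd j); first exact: imset_f.
(* With u = -(v alpha^-1), u - u alpha = v - v alpha^-1. *)
apply/imsetP; exists (- (alpha^-1%g v))%R => //.
by rewrite autzN // permKV opprK addrC.
Qed.

Lemma linner_hol_sub x y : linner (x : Q) (y : Q) \in hol_perm @* S1.
Proof.
case: x y => [i u] [j v].
have aut : (if odd i && odd j then alpha else 1) \in Aut [set: G].
  by case: ifP => _; rewrite ?group1.
have [w [w1 w2]] := hol_pair_ex (if odd i then if odd j then v - alpha v else
  alpha^-1%g v - v else 0)%R aut.
rewrite (linner_hol _ w1 w2); apply: mem_hol_perm; apply/hol_subP.
rewrite w1 w2; split; first by case: ifP; rewrite ?group1 ?cycle_id.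
case: (odd i); last exact: img_1sub0.
case: (odd j); first exact: imset_f.
by apply/imsetP; exists (alpha^-1%g v) => //; rewrite permKV.
Qed.

(** Taking v = 0 gives (alpha, 0); then (1, z) = (alpha, 0)^-1 (alpha, z), and (alpha^n, z) =
    (alpha, 0)^n (1, z). Stated for arbitrary [X] to serve right and left inner maps alike. *)
Lemma gen_hol_sub_cycle (X : {set {perm Q}}) : X \subset hol_perm @* S1 ->
    (forall w v, w.1 = alpha -> w.2 = (v - alpha v)%R -> hol_perm w \in X) ->
  <<X>> = hol_perm @* S1.
Proof.
move=> sXS genX; apply/eqP; rewrite eqEsubset gen_subG sXS /=.
rewrite sub_morphim_pre ?subsetT //; set K := _ @*^-1 _.
have KP w v : w.1 = alpha -> w.2 = (v - alpha v)%R -> w \in K.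
  by move=> w1 w2; rewrite !inE mem_gen //; apply: genX w1 w2.
have [wa [wa1 wa2]] := hol_pair_ex 0%R alpha_aut.
have Ka : wa \in K by apply: (KP _ 0%R); rewrite // wa2 autz0 // subr0.
have KX n : (wa ^+ n).1 = alpha ^+ n /\ (wa ^+ n).2 = 0%R.
  elim: n => [|n [IH1 IH2]]; first by [].
  by rewrite !expgSr hol_mul1 hol_mul2 IH1 IH2 wa1 wa2 autz0 ?addr0.
apply/subsetP=> w /hol_subP[/cycleP[n w1] /imsetP[v _ w2]].
have [wb [wb1 wb2]] := hol_pair_ex w.2 alpha_aut.
have [wc [wc1 wc2]] := hol_pair_ex w.2 (group1 (Aut [set: G])).
have Kc : wc \in K.
  suff -> : wc = wa^-1 * wb by rewrite groupM ?groupV // (KP _ v) // wb2.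
  rewrite -[LHS](mulKg wa); congr (_ * _); apply: hol_eq.
    by rewrite hol_mul1 wc1 wa1 wb1 mulg1.
  by rewrite hol_mul2 wc1 wc2 wa2 wb2 perm1 add0r.
suff -> : w = wa ^+ n * wc by rewrite groupM ?groupX.
have [wn1 wn2] := KX n; apply: hol_eq; first by rewrite hol_mul1 wn1 wc1 mulg1.
by rewrite hol_mul2 wn2 wc1 wc2 perm1 add0r.
Qed.

Lemma Inn_rE : Inn_r Q = hol_perm @* S1.
Proof.
apply: gen_hol_sub_cycle => [|w v w1 w2].
  by apply/subsetP=> _ /imset2P[x y _ _ ->]; apply: rinner_hol_sub.
apply/imset2P; exists ((1%R, 0%R) : Q) ((1%R, v) : Q) => //.
by apply/esym/rinner_hol; rewrite ?w1 ?w2 //= modn_small.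
Qed.

Lemma Inn_lE : Inn_l Q = hol_perm @* S1.
Proof.
apply: gen_hol_sub_cycle => [|w v w1 w2].
  by apply/subsetP=> _ /imset2P[x y _ _ ->]; apply: linner_hol_sub.
apply/imset2P; exists ((1%R, 0%R) : Q) ((1%R, v) : Q) => //.
by apply/esym/linner_hol; rewrite ?w1 ?w2 //= modn_small.
Qed.

Lemma tinner_hol_sub (x : Q) : tinner x \in hol_perm @* S2.
Proof.
case: x => i u.
have aut : (if odd i then opp_perm G else 1) \in Aut [set: G].
  by case: ifP => _; rewrite ?group1 ?opp_perm_aut.
have [w [w1 w2]] := hol_pair_ex (u *+ 2)%R aut.
rewrite (tinner_hol w1 w2); apply: mem_hol_perm; apply/hol_subP.
rewrite w1 w2 -[(u *+ 2)%R]addr0; split; last first.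
  by rewrite mem_sumset ?img_1sub0 //; apply: imset_f.
by rewrite -[X in X \in _]mulg1 mem_pm_cycle //; case: ifP;
  rewrite !inE eqxx ?orbT.
Qed.

Lemma gen_hol_sub_pm_cycle (X : {set {perm Q}}) : <<X>> = hol_perm @* S1 ->
  <<tinners Q :|: X>> = hol_perm @* S2.
Proof.
move=> genX; apply/eqP; rewrite eqEsubset gen_subG subUset -andbA.
have sX : X \subset hol_perm @* S2.
  by apply: subset_trans (subset_gen X) _;
  rewrite genX morphimS // hol_sub_cycle_subset.
rewrite sX; apply/and3P; split=> //.
  by apply/subsetP=> _ /imsetP[x _ ->]; apply: tinner_hol_sub.
rewrite sub_morphim_pre ?subsetT //; set K := _ @*^-1 _.
have K1 : S1 \subset K.
  by rewrite -sub_morphim_pre ?subsetT // -genX genS // subsetUr.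
have KT w i u : w.1 = (if odd (i : 'Z_m) then opp_perm G else 1) ->
    w.2 = (u *+ 2)%R -> w \in K.
  move=> w1 w2; rewrite !inE /= -(tinner_hol w1 w2) mem_gen //.
  by rewrite inE; apply/orP; left; apply: imset_f.
apply/subsetP=> w /hol_subP[/imset2P[e a Oe Aa w1]].
case/imset2P=> [_ v /imsetP[u _ ->] Iv w2].
have aut_e : e \in Aut [set: G].
  by case/set2P: Oe => ->; rewrite ?group1 ?opp_perm_aut.
have aut_a := pow_aut alpha_aut Aa.
have [we [we1 we2]] := hol_pair_ex 0%R aut_e.
have [wa [wa1 wa2]] := hol_pair_ex v aut_a.
have [wu [wu1 wu2]] := hol_pair_ex (u *+ 2)%R (group1 (Aut [set: G])).
(* The factorization (e a, 2u + v) = (e, 0) (a, v) (1, 2u): the middle factor lies in [S1], the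
   outer ones come from maps T_x. *)
have -> : w = we * wa * wu.
  apply: hol_eq; rewrite ?hol_mul1 ?hol_mul2 wu1 ?wu2 ?wa1 ?wa2
    ?we1 ?we2 ?mulg1 //.
  by rewrite perm1 autz0 // add0r addrC.
have Ka : wa \in K by apply: (subsetP K1); apply/hol_subP; rewrite wa1 wa2.
have Ku : wu \in K by apply: (KT _ 0%R u).
rewrite !groupM //.
(* (1, 0) comes from T at (0, 0), and (-1, 0) from T at (1, 0). *)
case/set2P: Oe => ee; [apply: (KT _ 0%R 0%R) | apply: (KT _ 1%R 0%R)].
all: by rewrite ?we1 ?we2 ?mul0rn //= modn_small.
Qed.

(** * The multiplication group and the inner mapping group *)

Lemma hol_perm_conj w (x : Q) : commute w.1 alpha ->
  rtrans x * hol_perm w = hol_perm w * rtrans (hol_perm w x).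
Proof.
by move=> ca; apply/permP=> p; rewrite !permM !permE; apply: hol_fun_mul.
Qed.

(** Induction on word length. A factor R_y is absorbed by R_x R_y = R_{x,y} R_{xy}; a factor L_y is
    T_y^-1 R_y, and T_y^-1 moves left past R_x because it is an automorphism. *)
Lemma Mlt_factor (phi : {perm Q}) : phi \in Mlt Q ->
  exists2 psi, psi \in hol_perm @* S2 & exists x : Q, phi = psi * rtrans x.
Proof.
have stepR psi (x y : Q) : psi \in hol_perm @* S2 ->
    exists2 psi', psi' \in hol_perm @* S2 &
      exists z : Q, psi * rtrans x * rtrans y = psi' * rtrans z.
  move=> Spsi; exists (psi * rinner x y).
    by rewrite groupM // (subsetP (morphimS _ hol_sub_cycle_subset)) //
      rinner_hol_sub.
  by exists (loop_mul x y); rewrite /rinner !mulgA mulgKV.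
(* In a finite group generated elements are products of generators, so inverses of translations need
   no case. *)
case/gen_prodgP=> n [c Xc ->]; elim: n c Xc => [|n IHn] c Xc.
  exists 1; rewrite ?group1 // big_ord0; exists (loop_one Q).
  by rewrite mul1g; apply/permP=> p; rewrite perm1 permE loop_mulr1.
rewrite big_ord_recr /=.
have [//|psi Spsi [x ->]] :=
  IHn (fun i => c (widen_ord (leqnSn n) i)).
case/setUP: (Xc ord_max) => /imsetP[y _ ->]; last exact: stepR.
have -> : ltrans y = (tinner y)^-1 * rtrans y.
  by rewrite /tinner invMg invgK -mulgA mulVg mulg1.
have : (tinner y)^-1 \in hol_perm @* S2 by rewrite groupV tinner_hol_sub.
case/morphimP=> w _ Sw ->; rewrite mulgA -(mulgA psi) hol_perm_conj ?mulgA.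
  by apply: stepR; rewrite groupM // mem_hol_perm.
by case/hol_subP: Sw => /(pm_cycle_commute alpha_aut).
Qed.

Lemma hol_perm1 w : hol_perm w (loop_one Q) = loop_one Q.
Proof. by rewrite permE /hol_fun /= autz0 ?hol_aut. Qed.

(** In a factorization psi R_x, psi fixes the identity and R_x sends it to x; hence fixing the
    identity forces x to be the identity and R_x = 1. Conversely the T_x and R_{x,y}, which generate
    the image, are products of translations and their inverses. *)
Lemma InnE : Inn Q = hol_perm @* S2.
Proof.
apply/eqP; rewrite eqEsubset; apply/andP; split; apply/subsetP=> phi.
  rewrite inE => /andP[/Mlt_factor[psi Spsi [x ->]]].
  case/morphimP: (Spsi) => w _ _ psiE; rewrite permM {1}psiE hol_perm1 permE.
  rewrite loop_mul1 => /eqP ->.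
  suff -> : rtrans (loop_one Q) = 1 by rewrite mulg1.
  by apply/permP=> p; rewrite perm1 permE loop_mulr1.
move=> Sphi; rewrite inE; apply/andP; split; last first.
  by case/morphimP: Sphi => w _ _ ->; rewrite hol_perm1.
have LM x : ltrans x \in Mlt Q by rewrite mem_gen // inE imset_f.
have RM x : rtrans x \in Mlt Q by rewrite mem_gen // inE orbC imset_f.
move: Sphi; rewrite -(gen_hol_sub_pm_cycle Inn_rE); apply: subsetP.
rewrite gen_subG.
apply/subsetP=> _ /setUP[/imsetP[x _ ->]|/imset2P[x y _ _ ->]].
  by rewrite groupM ?groupV.
by rewrite !groupM ?groupV.
Qed.
End HolAction.

Theorem theorem6p3 (m : nat) (G : finZmodType) (alpha : {perm G})
    (m_ge2 : 2 <= m) (m_even : ~~ odd m)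
    (alpha_aut : alpha \in Aut [set: G])
    (alpha_sqr : 2 < m -> alpha ^+ 2 = 1)
    (nontriv : alpha <> 1 \/ exists u : G, (u *+ 2 <> 0)%R) :
  let Q : finLoopType := dih_loop m alpha in
  [/\ Inn_r Q = Inn_l Q,
      Inn_r Q \isog hol_sub <[alpha]> (img_1sub alpha),
      Inn Q = <<tinners Q :|: rinners Q>>,
      Inn Q = <<tinners Q :|: linners Q>>
    & Inn Q \isog
        hol_sub (pm_cycle alpha) (sumset (img_double G) (img_1sub alpha))].
Proof.
have RE := Inn_rE m_ge2 m_even alpha_aut alpha_sqr.
have LE := Inn_lE m_ge2 m_even alpha_aut alpha_sqr.
have IE := InnE m_ge2 m_even alpha_aut alpha_sqr.
have inj := injm_hol_perm m alpha.
have isoS (S : {group hol G}) : hol_perm m alpha @* S \isog S.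
  by rewrite isog_sym sub_isog ?subsetT.
split.
- by rewrite RE LE.
- by rewrite RE isoS.
- by rewrite IE (gen_hol_sub_pm_cycle m_ge2 alpha_sqr RE).
- by rewrite IE (gen_hol_sub_pm_cycle m_ge2 alpha_sqr LE).
- by rewrite IE isoS.
Qed.
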